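(* Let $n,k\ge 1$ and let $\mathbf{C}=(C_0,C_1,\dots,C_k)$ be a $(k+1)$-tuple of real $n\times n$ matrices. The following are equivalent: (i) $\mathbf{C}$ has the column $W$-property. (ii) $\mathbf{C}$ has the cS-$W$ property and the column ND-$W$ property. (iii) $\mathbf{C}$ has the column $W_0$-property and the column ND-$W$ property.
   Context: Notation: $[m]=\{1,\dots,m\}$; for $u,v\in\mathbb{R}^n$, $u*v$ is the componentwise product, and $u\ge 0$, $u\le 0$ are understood componentwise. Column representative: a matrix $R\in\mathbb{R}^{n\times n}$ is a column representative of $\mathbf{C}=(C_0,\dots,C_k)$ if for each $j\in[n]$ the $j$-th column of $R$ belongs to the set consisting of the $j$-th columns of $C_0,C_1,\dots,C_k$. Column $W$-property: the determinants of all column representatives of $\mathbf{C}$ are all positive or all negative. Column $W_0$-property: either the determinants of all column representatives of $\mathbf{C}$ are nonnegative and at least one is positive, or they are all nonpositive and at least one is negative. cS-$W$ (column sufficient-$W$) property: for all $x_0,x_1,\dots,x_k\in\mathbb{R}^n$ with $C_0x_0=\sum_{i=1}^k C_ix_i$, $x_0*x_i\le 0$ for all $i\in[k]$, and $x_i*x_j\ge 0$ for all $1\le i<j\le k$, one has $x_i*x_{i+1}=0$ for all $0\le i\le k-1$. Column ND-$W$ (column nondegenerate-$W$) property: for all $x_0,x_1,\dots,x_k\in\mathbb{R}^n$ with $C_0x_0=\sum_{i=1}^kC_ix_i$ and $x_i*x_j=0$ for all $0\le i<j\le k$, one has $x_0=x_1=\cdots=x_k=0$. *)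

(* Defs.v *)
From mathcomp Require Import all_boot all_order all_algebra.
From mathcomp Require Import reals.

Set Implicit Arguments.
Unset Strict Implicit.
Unset Printing Implicit Defensive.

Import Order.TTheory GRing.Theory Num.Theory.

Local Open Scope ring_scope.

Definition cwprod (R : realType) (n : nat) (u v : 'cV[R]_n) : 'cV[R]_n :=
  map2_mx *%R u v.

Definition cw_ge0 (R : realType) (n : nat) (u : 'cV[R]_n) : Prop :=
  forall l, 0 <= u l 0.

Definition cw_le0 (R : realType) (n : nat) (u : 'cV[R]_n) : Prop :=
  forall l, u l 0 <= 0.

Definition column_representative (R : realType) (n k : nat)
    (C : 'I_k.+1 -> 'M[R]_n) (A : 'M[R]_n) : Prop :=
  forall j : 'I_n, exists i : 'I_k.+1, col j A = col j (C i).

Definition column_W (R : realType) (n k : nat)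
    (C : 'I_k.+1 -> 'M[R]_n) : Prop :=
  (forall A, column_representative C A -> 0 < \det A) \/
  (forall A, column_representative C A -> \det A < 0).

Definition column_W0 (R : realType) (n k : nat)
    (C : 'I_k.+1 -> 'M[R]_n) : Prop :=
  ((forall A, column_representative C A -> 0 <= \det A) /\
   (exists A, column_representative C A /\ 0 < \det A)) \/
  ((forall A, column_representative C A -> \det A <= 0) /\
   (exists A, column_representative C A /\ \det A < 0)).

Definition cSW (R : realType) (n k : nat)
    (C : 'I_k.+1 -> 'M[R]_n) : Prop :=
  forall x : 'I_k.+1 -> 'cV[R]_n,
    C ord0 *m x ord0 = \sum_(i < k.+1 | (0 < i)%N) C i *m x i ->
    (forall i : 'I_k.+1, (0 < i)%N -> cw_le0 (cwprod (x ord0) (x i))) ->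
    (forall i j : 'I_k.+1, (0 < i < j)%N -> cw_ge0 (cwprod (x i) (x j))) ->
    forall i j : 'I_k.+1, j = i.+1 :> nat -> cwprod (x i) (x j) = 0.

Definition column_NDW (R : realType) (n k : nat)
    (C : 'I_k.+1 -> 'M[R]_n) : Prop :=
  forall x : 'I_k.+1 -> 'cV[R]_n,
    C ord0 *m x ord0 = \sum_(i < k.+1 | (0 < i)%N) C i *m x i ->
    (forall i j : 'I_k.+1, (i < j)%N -> cwprod (x i) (x j) = 0) ->
    forall i : 'I_k.+1, x i = 0.

(* Main.v *)
Require Import Defs.
From mathcomp Require Import all_boot all_order all_algebra.
From mathcomp Require Import reals.
From mathcomp Require Import ring lra.

(** All three conditions say that the column representatives have nonzero
    determinants of one common sign.

    Replacing [x_0] by [-x_0] turns the equation of both the cS-W and the ND-W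
    property into the symmetric [\sum_i C_i y_i = 0], and turns their sign
    conditions into conditions on the pairwise products [y_i * y_j].

    A family [y_i] whose entries in each row have one sign can be written
    [y_i l = w l i * v l] with weights [w l i >= 0], not all zero for a given
    [l], and then
    [\sum_i C_i y_i = mix w v], where the columns of [mix w] are nonnegative
    combinations of the corresponding columns of the [C_i].  Multilinearity of
    the determinant expands [\det (mix w)] as a nonnegative combination of the
    determinants of the representatives ([det_mix]).  Under the column
    W-property [mix w] is therefore invertible, so every such family is zero
    ([same_sign_family_eq0]); this contains both the cS-W and the ND-W property.

    Conversely, a vector killed by a representative gives a family with
    disjoint supports, so the ND-W property makes all representatives
    nonsingular ([NDW_det_neq0]); with the column W_0-property this is the
    column W-property.  If moreover the cS-W property holds, two representatives
    that differ in one column, taken from [C_p] and from [C_(p+1)], have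
    determinants of the same sign: otherwise a positive combination of the two
    is singular, and a kernel vector yields a family violating cS-W
    ([adjacent_same_sign]).  Any representative is linked to [C_0] by
    such steps, so all determinants have the sign of [\det C_0]. *)

Set Implicit Arguments.
Unset Strict Implicit.
Unset Printing Implicit Defensive.

Import Order.TTheory GRing.Theory Num.Theory.

Local Open Scope ring_scope.

Section ColumnProperties.

Variables (R : realType) (n k : nat) (C : 'I_k.+1 -> 'M[R]_n).

Implicit Types (f g : {ffun 'I_n -> 'I_k.+1}) (w : 'I_n -> 'I_k.+1 -> R).
Implicit Types (x y : 'I_k.+1 -> 'cV[R]_n) (v : 'cV[R]_n).

(** * Representatives and nonnegative mixtures of columns *)

Definition rep f : 'M[R]_n := \matrix_(a, l) C (f l) a l.

Definition mix w : 'M[R]_n := \matrix_(a, l) \sum_i w l i * C i a l.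

(** It suffices to quantify over choice functions, of which there are finitely
    many. *)
Lemma column_representativeP A :
  column_representative C A <-> exists f, A = rep f.
Proof.
split=> [/fin_all_exists [f Af] | [f ->] l]; last first.
  by exists (f l); apply/colP=> a; rewrite !mxE.
exists (finfun f); apply/matrixP=> a l.
by have /colP/(_ a) := Af l; rewrite !mxE ffunE.
Qed.

Lemma mulmx_mix w v :
  \sum_i C i *m (\col_l (w l i * v l 0)) = mix w *m v.
Proof.
apply/colP=> a; rewrite summxE !mxE.
under eq_bigr do rewrite mxE.
rewrite exchange_big /=; apply: eq_bigr => l _.
rewrite !mxE mulr_suml; apply: eq_bigr => i _.
by rewrite !mxE; ring.
Qed.

Lemma rep_mix f : rep f = mix (fun l i => (i == f l)%:R).
Proof.
apply/matrixP=> a l; rewrite !mxE (bigD1 (f l)) //= eqxx mul1r big1 ?addr0 //.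
by move=> i /negPf ->; rewrite mul0r.
Qed.

Lemma det_mix w :
  \det (mix w) = \sum_(f : {ffun 'I_n -> 'I_k.+1})
    (\prod_l w l (f l)) * \det (rep f).
Proof.
(* After transposing, row [l] of the Leibniz product only involves the
   weights of column [l], so distributing needs no reindexing. *)
rewrite -det_tr [LHS]/determinant.
under [RHS]eq_bigr do rewrite -det_tr /determinant mulr_sumr.
rewrite exchange_big /=; apply: eq_bigr => s _.
under eq_bigr do rewrite !mxE.
rewrite bigA_distr_bigA mulr_sumr; apply: eq_bigr => f _.
rewrite big_split /= mulrCA; congr (_ * (_ * _)).
by apply: eq_bigr => l _; rewrite !mxE.
Qed.

(** Allowing any real [e], not only 1 and -1, lets the determinant of one
    representative play its role. *)
Definition common_sign (e : R) := forall f, 0 < e * \det (rep f).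

Lemma column_W_common_sign : column_W C -> exists e, common_sign e.
Proof.
by case=> CW; [exists 1 | exists (-1)] => f;
  rewrite ?mul1r ?mulN1r ?oppr_gt0; apply: CW; apply/column_representativeP;
  exists f.
Qed.

(** All terms of the expansion have the sign of [e], and the one that selects a
    positive weight for every column is nonzero. *)
Lemma common_sign_mix_neq0 e w :
  common_sign e -> (forall l i, 0 <= w l i) -> (forall l, exists i, 0 < w l i) ->
  \det (mix w) != 0.
Proof.
move=> e_sgn w_ge0 /fin_all_exists [f w_f].
have prod_ge0 g : 0 <= \prod_l w l (g l) by apply: prodr_ge0.
suff: 0 < e * \det (mix w) by apply: contraTneq => ->; rewrite mulr0 ltxx.
rewrite det_mix mulr_sumr (bigD1 (finfun f)) //=; apply: ltr_pwDl.
  rewrite mulrCA mulr_gt0 // prodr_gt0 // => l _.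
  by rewrite ffunE w_f.
by apply: sumr_ge0 => g _; rewrite mulrCA mulr_ge0 // ltW.
Qed.

(** * Families whose entries have one sign in each row *)

(** If some entry of the row is nonzero, dividing by one such entry makes the
    row nonnegative; the row is thus a multiple of nonnegative weights. *)
Lemma same_sign_row (u : 'I_k.+1 -> R) : (forall i j, 0 <= u i * u j) ->
  exists (w : 'I_k.+1 -> R) (c : R),
    [/\ forall i, 0 <= w i, exists i, 0 < w i & forall i, u i = w i * c].
Proof.
move=> u_sgn; case: (pickP (fun i => u i != 0)) => [m um_neq0 | u0].
  exists (fun i => u i / u m), (u m); split=> [i||i].
  - have -> : u i / u m = u i * u m / u m ^+ 2 by field.
    by rewrite divr_ge0 ?sqr_ge0.
  - by exists m; rewrite divff ?ltr01.
  - by rewrite divfK.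
exists (fun=> 1), 0; split=> [i||i]; first exact: ler01.
- by exists ord0; apply: ltr01.
- by rewrite mulr0; apply/eqP/negbFE/u0.
Qed.

Lemma same_sign_family_eq0 e y : common_sign e ->
  \sum_i C i *m y i = 0 -> (forall i j l, 0 <= y i l 0 * y j l 0) ->
  forall i, y i = 0.
Proof.
move=> e_sgn Cy0 y_sgn.
have /fin_all_exists [w /fin_all_exists [c wc]] :
    forall l, exists (w : 'I_k.+1 -> R) (c : R),
    [/\ forall i, 0 <= w i, exists i, 0 < w i & forall i, y i l 0 = w i * c].
  by move=> l; apply: same_sign_row => i j; apply: y_sgn.
have yE i : y i = \col_l (w l i * (\col_l c l) l 0).
  by apply/colP=> l; rewrite !mxE; case: (wc l) => _ _ ->.
have mix_unit : mix w \in unitmx.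
  rewrite unitmxE unitfE; apply: common_sign_mix_neq0 e_sgn _ _ => l.
    by case: (wc l).
  by case: (wc l).
have c0 : \col_l c l = 0 :> 'cV[R]_n.
  rewrite -[LHS](mulKmx mix_unit) -mulmx_mix.
  under eq_bigr do rewrite -yE.
  by rewrite Cy0 mulmx0.
by move=> i; rewrite yE c0; apply/colP=> l; rewrite !mxE mulr0.
Qed.

(** * The symmetric form of the equation *)

(** Moves [C_0 x_0] to the other side of the equation. *)
Definition flip0 x : 'I_k.+1 -> 'cV[R]_n :=
  fun i => if i == ord0 then - x i else x i.

Lemma flip0S x (i : 'I_k.+1) : (0 < i)%N -> flip0 x i = x i.
Proof. by rewrite /flip0 -val_eqE /= lt0n => /negPf ->. Qed.

Lemma flip0_eq x :
  C ord0 *m x ord0 = \sum_(i < k.+1 | (0 < i)%N) C i *m x i <->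
  \sum_i C i *m flip0 x i = 0.
Proof.
have -> : \sum_i C i *m flip0 x i =
    \sum_(i < k.+1 | (0 < i)%N) C i *m x i - C ord0 *m x ord0.
  rewrite (bigD1 ord0) //= addrC {2}/flip0 eqxx mulmxN; congr (_ - _).
  apply: eq_big => [i | i i_neq0]; first by rewrite -val_eqE /= lt0n.
  by rewrite flip0S // lt0n.
by split=> [->|/eqP]; rewrite ?subrr // subr_eq0 => /eqP.
Qed.

Lemma flip0K x i : flip0 (flip0 x) i = x i.
Proof. by rewrite /flip0; case: eqP => // _; rewrite opprK. Qed.

Lemma flip0_eq0 x i : (flip0 x i == 0) = (x i == 0).
Proof. by rewrite /flip0; case: (i == ord0); rewrite // oppr_eq0. Qed.

Lemma flip0_prod_eq0 x i j l :
  (flip0 x i l 0 * flip0 x j l 0 == 0) = (x i l 0 * x j l 0 == 0).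
Proof.
by rewrite /flip0; case: (i == ord0); case: (j == ord0);
  rewrite ?mxE ?mulNr ?mulrN ?opprK ?oppr_eq0.
Qed.

Lemma flip0_same_sign x :
  (forall i j l, 0 <= flip0 x i l 0 * flip0 x j l 0) <->
  (forall i : 'I_k.+1, (0 < i)%N -> cw_le0 (cwprod (x ord0) (x i))) /\
  (forall i j : 'I_k.+1, (0 < i < j)%N -> cw_ge0 (cwprod (x i) (x j))).
Proof.
have flip00 l : flip0 x ord0 l 0 = - x ord0 l 0 by rewrite /flip0 eqxx !mxE.
split=> [y_sgn | [x0_sgn x_sgn] i j l].
  split=> [i i_gt0 | i j /andP[i_gt0 ij]] l; rewrite mxE.
    by have := y_sgn ord0 i l; rewrite flip00 flip0S // mulNr oppr_ge0.
  by have := y_sgn i j l; rewrite !flip0S // (ltn_trans i_gt0).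
wlog: i j / (i <= j)%N => [wlog_ij | ].
  by case: (leqP i j) => [|/ltnW] /wlog_ij //; rewrite mulrC.
rewrite leq_eqVlt => /orP[/eqP/val_inj -> | ij]; first by rewrite -expr2 sqr_ge0.
case: (posnP i) => [i0 | i_gt0]; last first.
  have i_lt_j : (0 < i < j)%N by rewrite i_gt0.
  by have := x_sgn i j i_lt_j l; rewrite mxE !flip0S // (ltn_trans i_gt0).
have -> : i = ord0 by apply: val_inj.
have j_gt0 : (0 < j)%N by rewrite -i0.
by rewrite flip00 flip0S // mulNr oppr_ge0; have := x0_sgn j j_gt0 l; rewrite mxE.
Qed.

Lemma cwprod_eq0 (u v : 'cV[R]_n) :
  cwprod u v = 0 <-> forall l, u l 0 * v l 0 = 0.
Proof.
split=> [/colP uv l | uv]; first by have := uv l; rewrite !mxE.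
by apply/colP=> l; rewrite !mxE.
Qed.

(** * From the column W-property to cS-W and ND-W *)

Lemma common_sign_cSW e : common_sign e -> cSW C.
Proof.
move=> e_sgn x /flip0_eq Cx x0_sgn x_sgn i j _.
have x_eq0 := same_sign_family_eq0 e_sgn Cx
  (iffRL (flip0_same_sign x) (conj x0_sgn x_sgn)).
apply/cwprod_eq0 => l.
have /eqP -> : x i == 0 by rewrite -flip0_eq0; apply/eqP/x_eq0.
by rewrite mxE mul0r.
Qed.

Lemma common_sign_NDW e : common_sign e -> column_NDW C.
Proof.
move=> e_sgn x /flip0_eq Cx x_disj i; apply/eqP; rewrite -flip0_eq0; apply/eqP.
apply: same_sign_family_eq0 e_sgn Cx _ i => i j l.
have [-> | ij] := eqVneq i j; first by rewrite -expr2 sqr_ge0.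
suff /eqP -> : flip0 x i l 0 * flip0 x j l 0 == 0 by [].
rewrite flip0_prod_eq0; apply/eqP; move: ij; rewrite -val_eqE neq_ltn.
case/orP=> /x_disj/cwprod_eq0/(_ l) //.
by rewrite mulrC.
Qed.

(** * From cS-W and ND-W to a common sign *)

Lemma NDW_family_eq0 y : column_NDW C -> \sum_i C i *m y i = 0 ->
  (forall i j l, i != j -> y i l 0 * y j l 0 = 0) -> forall i, y i = 0.
Proof.
move=> ndw Cy y_disj i; apply/eqP; rewrite -flip0_eq0; apply/eqP.
apply: ndw => [|a b ab]; first by apply/flip0_eq; under eq_bigr do rewrite flip0K.
apply/cwprod_eq0 => l; apply/eqP; rewrite flip0_prod_eq0 y_disj //.
by rewrite -val_eqE neq_ltn ab.
Qed.

Lemma cSW_family_eq0 y : cSW C -> \sum_i C i *m y i = 0 ->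
  (forall i j l, 0 <= y i l 0 * y j l 0) ->
  forall (i j : 'I_k.+1) l, j = i.+1 :> nat -> y i l 0 * y j l 0 = 0.
Proof.
move=> csw Cy y_sgn i j l ij; apply/eqP; rewrite -flip0_prod_eq0.
have [//|x0_sgn x_sgn] := iffLR (flip0_same_sign (flip0 y)) _.
  by move=> a b m; rewrite !flip0K.
have Cx := iffRL (flip0_eq (flip0 y)).
apply/eqP; move: l; apply/cwprod_eq0; apply: csw => //; apply: Cx.
by under eq_bigr do rewrite flip0K.
Qed.

Lemma singular_col_kernel (A : 'M[R]_n) :
  \det A = 0 -> exists2 v : 'cV[R]_n, v != 0 & A *m v = 0.
Proof.
move=> A0; have /det0P [u u_neq0 uA] : \det A^T == 0 by rewrite det_tr A0.
exists u^T; first by rewrite trmx_eq0.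
by apply: trmx_inj; rewrite trmx_mul trmxK uA trmx0.
Qed.

(** A kernel vector of a representative, with each coordinate given to the
    matrix that its column comes from, is a family with disjoint supports. *)
Lemma NDW_det_neq0 f : column_NDW C -> \det (rep f) != 0.
Proof.
move=> ndw; apply/eqP => /singular_col_kernel [v + fv]; apply/negP/negPn/eqP.
pose y i := \col_l ((i == f l)%:R * v l 0).
have y0 : forall i, y i = 0.
  apply: NDW_family_eq0 ndw _ _ => [|i j l ij].
    by rewrite (mulmx_mix (fun l i => (i == f l)%:R)) -rep_mix.
  rewrite !mxE; case: eqP => [fi|_]; rewrite ?mul0r //.
  by rewrite -fi eq_sym (negPf ij) mul0r mulr0.
apply/colP=> l; have /colP/(_ l) := y0 (f l).
by rewrite !mxE eqxx mul1r.
Qed.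

(** If the two determinants [a] and [b] had opposite signs, the matrix with
    column [m] equal to [`|b|] times that of [rep f] plus [`|a|] times that of
    [rep g] would have determinant [`|b| * a + `|a| * b = 0].  By cS-W a kernel
    vector vanishes at [m], so it is also a kernel vector of [rep f]. *)
Lemma adjacent_same_sign f g (m : 'I_n) : cSW C -> column_NDW C ->
  (forall l, l != m -> g l = f l) -> g m = (f m).+1 :> nat ->
  0 < \det (rep f) * \det (rep g).
Proof.
move=> csw ndw gf gm.
have a_neq0 := NDW_det_neq0 f ndw; have b_neq0 := NDW_det_neq0 g ndw.
set a := \det (rep f) in a_neq0 *; set b := \det (rep g) in b_neq0 *.
rewrite lt0r mulf_neq0 //= leNgt; apply/negP => ab_lt0.
pose w (l : 'I_n) (i : 'I_k.+1) : R :=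
  if l == m then `|b| * (i == f m)%:R + `|a| * (i == g m)%:R
  else (i == f l)%:R.
have w_ge0 l i : 0 <= w l i.
  by rewrite /w; case: eqP => _; rewrite ?addr_ge0 ?mulr_ge0.
have mix_other c l : l != m -> mix w c l = rep f c l.
  move=> lm; rewrite rep_mix !mxE; apply: eq_bigr => i _.
  by rewrite /w (negPf lm).
have mix_m c : mix w c m = `|b| * rep f c m + `|a| * rep g c m.
  rewrite (rep_mix f) (rep_mix g) !mxE !mulr_sumr -big_split /=.
  by apply: eq_bigr => i _; rewrite /w eqxx; ring.
have mix_sing : \det (mix w) = 0.
  have -> : \det (mix w) = `|b| * a + `|a| * b.
    have := @determinant_multilinear _ _ (mix w)^T (rep f)^T (rep g)^T m
      `|b| `|a|; rewrite !det_tr; apply.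
    - by apply/rowP=> c; rewrite [LHS]mxE [LHS]mxE mix_m !mxE.
    - apply/matrixP=> l c; rewrite [RHS]mxE [RHS]mxE.
      by rewrite mix_other 1?eq_sym ?neq_lift // !mxE.
    - apply/matrixP=> l c; rewrite [RHS]mxE [RHS]mxE.
      by rewrite mix_other 1?eq_sym ?neq_lift // !mxE gf // eq_sym neq_lift.
  have [a_ge0|a_lt0] := leP 0 a; have [b_ge0|b_lt0] := leP 0 b;
    rewrite ?(ger0_norm a_ge0) ?(ger0_norm b_ge0) ?(ltr0_norm a_lt0)
            ?(ltr0_norm b_lt0); nra.
have [v v_neq0 mixv] := singular_col_kernel mix_sing.
have vm0 : v m 0 = 0.
  pose y i := \col_l (w l i * v l 0).
  have := cSW_family_eq0 (y := y) csw _ _ m gm.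
  rewrite mulmx_mix mixv => /(_ erefl) yy0.
  have fg : (f m == g m) = false by rewrite -val_eqE /= gm ltn_eqF.
  apply/eqP; have /eqP : y (f m) m 0 * y (g m) m 0 = 0.
    apply: yy0 => i j l; rewrite !mxE mulrACA -expr2.
    by rewrite mulr_ge0 ?sqr_ge0 ?mulr_ge0.
  rewrite !mxE /w !eqxx fg (eq_sym (g m)) fg !mulr1 !mulr0 addr0 add0r.
  by rewrite !mulf_eq0 !normr_eq0 (negPf a_neq0) (negPf b_neq0) /= orbb.
have fv : rep f *m v = 0.
  rewrite -mixv; apply/colP=> c; rewrite !mxE; apply: eq_bigr => l _.
  have [-> | lm] := eqVneq l m; first by rewrite vm0 !mulr0.
  by rewrite mix_other.
move/eqP: v_neq0; apply; rewrite -[LHS](@mulKmx _ _ _ (rep f)) ?fv ?mulmx0 //.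
by rewrite unitmxE unitfE.
Qed.

(** Lowering one positive index at a time leads from any representative to
    [C_0] through representatives of the same sign. *)
Lemma cSW_NDW_common_sign : cSW C -> column_NDW C ->
  common_sign (\det (rep [ffun=> ord0])).
Proof.
move=> csw ndw f; set e := \det _.
have [N] := ubnP (\sum_l f l); elim: N f => // N IHN f.
rewrite ltnS => sum_f; case: (pickP (fun l => 0 < f l)%N) => [m fm_gt0 | f0].
  pose g := [ffun l => if l == m then inord (f m).-1 else f l].
  have gm : g m = (f m).-1 :> nat.
    by rewrite ffunE eqxx inordK // (leq_ltn_trans (leq_pred _) (ltn_ord _)).
  have gf l : l != m -> g l = f l by move=> /negPf lm; rewrite ffunE lm.
  have eg_gt0 : 0 < e * \det (rep g).
    apply: IHN; apply: leq_trans sum_f.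
    rewrite (bigD1 m) //= [X in (_ < X)%N](bigD1 m) //= gm.
    rewrite (eq_bigr (fun l => f l : nat)) => [|l /gf -> //].
    by rewrite ltn_add2r prednK.
  have gf_gt0 : 0 < \det (rep g) * \det (rep f).
    apply: (@adjacent_same_sign _ _ m) => // [l /gf //|].
    by rewrite gm prednK.
  have := mulr_gt0 eg_gt0 gf_gt0; rewrite mulrA -(mulrA e) -expr2 mulrAC.
  rewrite pmulr_lgt0 // lt0r sqr_ge0 andbT expf_neq0 //.
  exact: NDW_det_neq0.
have -> : f = [ffun=> ord0].
  apply/ffunP=> l; rewrite ffunE; apply: val_inj => /=.
  by apply/eqP; move: (f0 l); rewrite lt0n => /negbFE.
by rewrite -expr2 lt0r sqr_ge0 andbT expf_neq0 // NDW_det_neq0.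
Qed.

(** * The column W- and W_0-properties *)

Lemma common_sign_W0 e : common_sign e -> column_W0 C.
Proof.
move=> e_sgn; have f0 : {ffun 'I_n -> 'I_k.+1} := [ffun=> ord0].
have f0_rep : column_representative C (rep f0).
  by apply/column_representativeP; exists f0.
have := e_sgn f0; case: (ltgtP e 0) => [e_lt0|e_gt0|->]; last by rewrite mul0r ltxx.
  rewrite nmulr_rgt0 // => det_lt0; right; split; last by exists (rep f0).
  move=> A /column_representativeP [f ->].
  by have := e_sgn f; rewrite nmulr_rgt0 // => /ltW.
rewrite pmulr_rgt0 // => det_gt0; left; split; last by exists (rep f0).
move=> A /column_representativeP [f ->].
by have := e_sgn f; rewrite pmulr_rgt0 // => /ltW.
Qed.

Lemma W0_NDW_W : column_W0 C -> column_NDW C -> column_W C.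
Proof.
move=> W0 ndw.
have rep_neq0 A : column_representative C A -> \det A != 0.
  by move=> /column_representativeP [f ->]; apply: NDW_det_neq0.
case: W0 => [[det_sgn _]|[det_sgn _]]; [left | right] => A A_rep.
  by rewrite lt0r rep_neq0 // det_sgn.
by rewrite lt_neqAle rep_neq0 // det_sgn.
Qed.

End ColumnProperties.

Theorem theorem4p2 (R : realType) (n k : nat) (hn : (1 <= n)%N)
    (hk : (1 <= k)%N) (C : 'I_k.+1 -> 'M[R]_n) :
  [<-> column_W C;
       cSW C /\ column_NDW C;
       column_W0 C /\ column_NDW C].
Proof.
tfae=> [/column_W_common_sign [e e_sgn] | [csw ndw] | [W0 ndw]].
- by split; [apply: common_sign_cSW e_sgn | apply: common_sign_NDW e_sgn].
- by split=> //; apply: common_sign_W0 (cSW_NDW_common_sign csw ndw).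
- exact: W0_NDW_W.
Qed.
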